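(* Let $\mathcal{H}_N$, $\mathcal{H}_S$, $\mathcal{H}_T$ be finite-dimensional Hilbert spaces, let $\Phi=\Phi_{NS}$ be a density operator on $\mathcal{H}_N\otimes\mathcal{H}_S$ and $\Psi=\Psi_{NT}$ a density operator on $\mathcal{H}_N\otimes\mathcal{H}_T$. Then $\Phi$ is better than $\Psi$ (in the sense defined in the context) if and only if there exists a completely positive trace-preserving linear map $\mathcal{E}$ from operators on $\mathcal{H}_S$ to operators on $\mathcal{H}_T$ such that \[\Psi_{NT}=(\mathcal{I}_N\otimes\mathcal{E})\Phi_{NS},\] where $\mathcal{I}_N$ is the identity map on operators over $\mathcal{H}_N$.
   Context: An information structure is a triple $(\mathcal{H}_N,\mathcal{H}_S,\Phi_{NS})$ with $\mathcal{H}_N,\mathcal{H}_S$ finite-dimensional Hilbert spaces and $\Phi_{NS}$ a density operator on $\mathcal{H}_N\otimes\mathcal{H}_S$; the observer has access to $S$. A game is a tuple $(\mathcal{H}_A,\mathcal{H}_B,\rho_{AB},M^1,\dots,M^k)$ where $\mathcal{H}_A,\mathcal{H}_B$ are finite-dimensional Hilbert spaces (the environment), $\rho_{AB}$ is a density operator on $\mathcal{H}_A\otimes\mathcal{H}_B$, $k\ge 1$, and each $M^i$ is a Hermitian operator on $\mathcal{H}_N\otimes\mathcal{H}_B$. A strategy is a POVM $(D^1,\dots,D^k)$ on $\mathcal{H}_S\otimes\mathcal{H}_A$, i.e. positive semidefinite operators with $D^1+\dots+D^k=I$. The optimal payoff is \[R(\Phi_{NS};\rho_{AB},M^1,\dots,M^k)=\max_{(D^1,\dots,D^k)}\sum_{i=1}^k\operatorname{tr}\bigl((\Phi_{NS}\otimes\rho_{AB})(M^i_{NB}\otimes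 D^i_{SA})\bigr),\] the maximum over all strategies (tensor factors reordered appropriately). For information structures $\Phi_{NS}$ on $\mathcal{H}_N\otimes\mathcal{H}_S$ and $\Psi_{NT}$ on $\mathcal{H}_N\otimes\mathcal{H}_T$ (same $\mathcal{H}_N$), $\Phi$ is said to be better than $\Psi$ if for every finite-dimensional $\mathcal{H}_A,\mathcal{H}_B$, every density operator $\rho_{AB}$, every $k$ and every Hermitian $M^1,\dots,M^k$ on $\mathcal{H}_N\otimes\mathcal{H}_B$, one has $R(\Phi_{NS};\rho_{AB},M^1,\dots,M^k)\ge R(\Psi_{NT};\rho_{AB},M^1,\dots,M^k)$. *)

(* Defs.v *)
From HB Require Import structures.
From mathcomp Require Import all_boot all_order all_algebra.
From mathcomp Require Import all_classical all_reals.
From mathcomp Require Import complex mxtens.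

Set Implicit Arguments.
Unset Strict Implicit.
Unset Printing Implicit Defensive.

Import Order.TTheory GRing.Theory Num.Theory.
Local Open Scope ring_scope.
Local Open Scope classical_set_scope.

(* Throughout, R : realType is the field of real numbers and R[i] = C the
   complex numbers.  A d-dimensional Hilbert space is C^d; operators on it are
   'M[R[i]]_d.  The tensor product H_m (x) H_n is C^(m*n), with the Kronecker
   indexing convention of mxtens: (i,j) |-> mxtens_index (i,j) = i*n + j, so
   that (A *t B) (i,j) (k,l) = A i k * B j l. *)

Section Quantum.
Variable R : realType.
Local Notation C := (R[i]).

Definition adjmx m n (A : 'M[C]_(m, n)) : 'M[C]_(n, m) := (map_mx Num.conj A)^T.

Definition psdmx n (A : 'M[C]_n) : Prop :=
  adjmx A = A /\ forall v : 'rV[C]_n, 0 <= (v *m A *m adjmx v) 0 0.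

Definition hermitianmx n (A : 'M[C]_n) : Prop := adjmx A = A.

Definition density n (A : 'M[C]_n) : Prop := psdmx A /\ \tr A = 1.

Definition blockmx k n (X : 'M[C]_(k * n)) (a a' : 'I_k) : 'M[C]_n :=
  \matrix_(s, s') X (mxtens_index (a, s)) (mxtens_index (a', s')).

Definition id_tens k n p (E : 'M[C]_n -> 'M[C]_p) (X : 'M[C]_(k * n))
  : 'M[C]_(k * p) :=
  \matrix_(i, j)
    E (blockmx X (mxtens_unindex i).1 (mxtens_unindex j).1)
      (mxtens_unindex i).2 (mxtens_unindex j).2.

Definition completely_positive n p (E : 'M[C]_n -> 'M[C]_p) : Prop :=
  forall (k : nat) (X : 'M[C]_(k * n)), psdmx X -> psdmx (id_tens E X).

Definition trace_preserving n p (E : 'M[C]_n -> 'M[C]_p) : Prop :=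
  forall X : 'M[C]_n, \tr (E X) = \tr X.

Definition idx4 nN nS nA nB (i : 'I_((nN * nS) * (nA * nB))) :=
  let: (x, y) := mxtens_unindex i in
  (mxtens_unindex x, mxtens_unindex y).

(* The operator M_NB (x) D_SA, with tensor factors reordered to act on
   H_N (x) H_S (x) H_A (x) H_B (grouped as (N S)(A B)). *)
Definition reorder_tens nN nS nA nB (M : 'M[C]_(nN * nB)) (D : 'M[C]_(nS * nA))
  : 'M[C]_((nN * nS) * (nA * nB)) :=
  \matrix_(i, j)
    let: ((n, s), (a, b)) := idx4 i in
    let: ((n', s'), (a', b')) := idx4 j in
    M (mxtens_index (n, b)) (mxtens_index (n', b'))
    * D (mxtens_index (s, a)) (mxtens_index (s', a')).

Definition strategy nS nA k (D : 'I_k -> 'M[C]_(nS * nA)) : Prop :=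
  (forall i, psdmx (D i)) /\ \sum_(i < k) D i = 1%:M.

Definition payoff nN nS nA nB k (Phi : 'M[C]_(nN * nS)) (rho : 'M[C]_(nA * nB))
  (M : 'I_k -> 'M[C]_(nN * nB)) (D : 'I_k -> 'M[C]_(nS * nA)) : C :=
  \sum_(i < k) \tr ((Phi *t rho) *m reorder_tens (M i) (D i)).

(* Optimal payoff R(Phi; rho, M^1..M^k): the maximum over all strategies
   (the payoff is real; the maximum is attained, so it equals the sup). *)
Definition opt_payoff nN nS nA nB k (Phi : 'M[C]_(nN * nS))
  (rho : 'M[C]_(nA * nB)) (M : 'I_k -> 'M[C]_(nN * nB)) : R :=
  sup [set complex.Re (payoff Phi rho M D) | D in
        [set D : 'I_k -> 'M[C]_(nS * nA) | strategy D]].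

Definition better nN nS nT (Phi : 'M[C]_(nN * nS)) (Psi : 'M[C]_(nN * nT))
  : Prop :=
  forall (nA nB : nat) (rho : 'M[C]_(nA * nB)) (k : nat)
         (M : 'I_k -> 'M[C]_(nN * nB)),
    density rho -> (0 < k)%N -> (forall i, hermitianmx (M i)) ->
    opt_payoff Psi rho M <= opt_payoff Phi rho M.

End Quantum.

(* Main.v *)
(** A channel [S -> T] is encoded by its Choi matrix [G], and [link Phi G] is
    the structure obtained by applying it to the observer's part of [Phi].

    If [Psi = link Phi G], a strategy for [Psi] is pulled back along [G] to a
    strategy for [Phi] with the same payoff.

    Conversely, the structures [link Phi G] form a compact convex set of
    Hermitian matrices, so it is enough to bound [tr (Psi W)] by the supremum of
    the [tr (link Phi G W)], for every Hermitian [W].  Take for A and B two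
    copies of T in the maximally entangled state, and as payoff operators the
    conjugates of [W] by the unitaries of a 1-design.  A strategy for this game
    is a teleportation protocol: the observer of [Phi] who measures [D] gets
    [tr (link Phi G W)] for some channel [G], while the observer of [Psi] gets
    [tr (Psi W)] from the Bell measurement. *)

From HB Require Import structures.
From mathcomp Require Import all_boot all_order all_algebra.
From mathcomp Require Import all_classical all_reals.
From mathcomp Require Import complex mxtens spectral ring lra.
From mathcomp Require Import interval_inference topology normedtype.
From mathcomp Require Import derive convex.
Require Import Defs.

Set Implicit Arguments.
Unset Strict Implicit.
Unset Printing Implicit Defensive.

Import Order.TTheory GRing.Theory Num.Theory.
Import numFieldNormedType.Exports.
Local Open Scope ring_scope.

Section PositiveMatrices.
Variable R : realType.
Local Notation C := R[i].

Lemma adjmxE m n (A : 'M[C]_(m, n)) i j : adjmx A i j = (A j i)^*.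
Proof. by rewrite !mxE. Qed.

Lemma adjmx_trmxC m n (A : 'M[C]_(m, n)) : adjmx A = (A ^t* )%sesqui.
Proof. exact: map_trmx. Qed.

Lemma adjmxK m n : cancel (@adjmx R m n) (@adjmx R n m).
Proof. by move=> A; apply/matrixP => i j; rewrite !adjmxE conjCK. Qed.

Lemma adjmxM m n p (A : 'M[C]_(m, n)) (B : 'M[C]_(n, p)) :
  adjmx (A *m B) = adjmx B *m adjmx A.
Proof. by rewrite /adjmx map_mxM trmx_mul. Qed.

Lemma adjmxD m n : {morph @adjmx R m n : A B / A + B}.
Proof. by move=> A B; rewrite /adjmx map_mxD linearD. Qed.

Lemma adjmxB m n : {morph @adjmx R m n : A B / A - B}.
Proof. by move=> A B; rewrite /adjmx map_mxB linearB. Qed.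

Lemma adjmxZ m n a (A : 'M[C]_(m, n)) : adjmx (a *: A) = a^* *: adjmx A.
Proof. by rewrite /adjmx map_mxZ linearZ. Qed.

Lemma adjmx_scalar n a : adjmx (a%:M : 'M[C]_n) = a^*%:M.
Proof. by rewrite /adjmx map_scalar_mx tr_scalar_mx. Qed.

Lemma mxtrace_adjmx n (A : 'M[C]_n) : \tr (adjmx A) = (\tr A)^*.
Proof. by rewrite /adjmx mxtrace_tr -trace_map_mx. Qed.

Lemma psdmx_gram m n (K : 'M[C]_(m, n)) : psdmx (adjmx K *m K).
Proof.
split=> [|v]; first by rewrite adjmxM adjmxK.
have -> : v *m (adjmx K *m K) *m adjmx v
        = v *m adjmx K *m adjmx (v *m adjmx K) by rewrite adjmxM adjmxK !mulmxA.
by rewrite mxE; apply: sumr_ge0 => i _; rewrite adjmxE mul_conjC_ge0.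
Qed.

Lemma psdmx_normal n (A : 'M[C]_n) : psdmx A -> A \is normalmx.
Proof. by move=> [hermA _]; apply/normalmxP; rewrite -adjmx_trmxC hermA. Qed.

Lemma psdmx_spectral n (A : 'M[C]_n) : psdmx A ->
  A = adjmx (spectralmx A) *m diag_mx (spectral_diag A) *m spectralmx A.
Proof.
move=> /psdmx_normal/orthomx_spectralP.
by rewrite (invmx_unitary (spectral_unitarymx A)) adjmx_trmxC.
Qed.

Lemma psdmx_spectral_diag_ge0 n (A : 'M[C]_n) i :
  psdmx A -> 0 <= spectral_diag A 0 i.
Proof.
move=> psdA; have [_ /(_ (row i (spectralmx A)))] := psdA.
have -> : (row i (spectralmx A) *m A *m adjmx (row i (spectralmx A))) 0 0
        = (spectralmx A *m A *m adjmx (spectralmx A)) i i.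
  by rewrite -row_mul !mxE; apply: eq_bigr => j _; rewrite !mxE.
have /unitarymxP := spectral_unitarymx A; rewrite -adjmx_trmxC => unitP.
rewrite [X in _ *m X *m _](psdmx_spectral psdA) -!mulmxA unitP mulmx1 mulmxA.
by rewrite unitP mul1mx mxE eqxx.
Qed.

Lemma psdmxP n (A : 'M[C]_n) : psdmx A <-> exists K : 'M[C]_n, A = adjmx K *m K.
Proof.
split=> [psdA|[K ->]]; last exact: psdmx_gram.
exists (diag_mx (map_mx sqrtC (spectral_diag A)) *m spectralmx A).
rewrite adjmxM mulmxA -[_ *m _ *m diag_mx _]mulmxA {1}(psdmx_spectral psdA).
congr (_ *m _ *m _); rewrite /adjmx map_diag_mx tr_diag_mx mulmx_diag.
congr diag_mx; apply/rowP => i; rewrite !mxE /= conj_Creal.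
  by rewrite -expr2 sqrtCK.
by rewrite ger0_real // sqrtC_ge0 psdmx_spectral_diag_ge0.
Qed.

Lemma psdmx0 n : psdmx (0 : 'M[C]_n).
Proof. by apply/psdmxP; exists 0; rewrite mulmx0. Qed.

Lemma psdmxD n (A B : 'M[C]_n) : psdmx A -> psdmx B -> psdmx (A + B).
Proof.
move=> [hermA psdA] [hermB psdB]; split=> [|v].
  by rewrite adjmxD hermA hermB.
by rewrite mulmxDr mulmxDl mxE addr_ge0.
Qed.

Lemma psdmxZ n (a : C) (A : 'M[C]_n) : 0 <= a -> psdmx A -> psdmx (a *: A).
Proof.
move=> a_ge0 [hermA psdA]; split=> [|v].
  by rewrite adjmxZ hermA conj_Creal ?ger0_real.
by rewrite -scalemxAr -scalemxAl mxE mulr_ge0.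
Qed.

Lemma psdmx_sum n (I : finType) (F : I -> 'M[C]_n) :
  (forall i, psdmx (F i)) -> psdmx (\sum_i F i).
Proof.
move=> psdF; apply: (big_ind (@psdmx R n)) => [||i _]; last exact: psdF.
  exact: psdmx0.
exact: psdmxD.
Qed.

Lemma psdmx_scalar n (a : C) : 0 <= a -> psdmx (a%:M : 'M[C]_n).
Proof.
move=> a_ge0; rewrite -scalemx1; apply: psdmxZ => //.
by apply/psdmxP; exists 1%:M; rewrite adjmx_scalar conjC1 mulmx1.
Qed.

Lemma psdmx_tr n (A : 'M[C]_n) : psdmx A -> psdmx A^T.
Proof.
move=> /psdmxP[K ->]; apply/psdmxP; exists (map_mx Num.conj K).
rewrite trmx_mul; congr (_ *m _).
  by apply/matrixP => i j; rewrite !mxE conjCK.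
by rewrite /adjmx trmxK.
Qed.

Lemma psdmx_trace_ge0 n (A : 'M[C]_n) : psdmx A -> 0 <= \tr A.
Proof.
move=> /psdmxP[K ->]; apply: sumr_ge0 => i _; rewrite mxE.
by apply: sumr_ge0 => j _; rewrite adjmxE mulrC mul_conjC_ge0.
Qed.

Lemma psdmx_normr_le_trace n (A : 'M[C]_n) i j : psdmx A -> `|A i j| <= \tr A.
Proof.
move=> /psdmxP[K ->].
have diagE k : (adjmx K *m K) k k = \sum_l `|K l k| ^+ 2.
  by rewrite mxE; apply: eq_bigr => l _; rewrite adjmxE mulrC normCK.
have diag_ge0 k : 0 <= (adjmx K *m K) k k.
  by rewrite diagE sumr_ge0 // => l _; rewrite exprn_ge0.
have diag_le_trace k : (adjmx K *m K) k k <= \tr (adjmx K *m K).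
  by rewrite /mxtrace (bigD1 k) //= lerDl sumr_ge0.
suff: `|(adjmx K *m K) i j| *+ 2 <= \tr (adjmx K *m K) *+ 2 by rewrite lerMn2r.
rewrite [leRHS]mulr2n.
apply: le_trans (lerD (diag_le_trace i) (diag_le_trace j)).
rewrite !diagE -big_split /= mxE.
apply: (@le_trans _ _ ((\sum_l `|K l i| * `|K l j|) *+ 2)).
  rewrite lerMn2r /=; apply: le_trans (ler_norm_sum _ _ _) _.
  by apply: ler_sum => l _; rewrite adjmxE normrM norm_conjC.
rewrite -sumrMnl; apply: ler_sum => l _.
by apply: (real_leif_mean_square_scaled _ _).1; exact: normr_real.
Qed.

End PositiveMatrices.

Local Notation ix i j := (mxtens_index (i, j)).

Section TensorIndices.

Lemma sum_mxtens_index (V : nmodType) m n (F : 'I_(m * n) -> V) :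
  \sum_x F x = \sum_i \sum_j F (ix i j).
Proof.
rewrite pair_bigA (reindex (@mxtens_index m n)) /=.
  by apply: eq_bigr => -[].
by exists (@mxtens_unindex m n) => i _; rewrite ?mxtens_indexK ?mxtens_unindexK.
Qed.

Lemma sum_pair_delta (A : pzSemiRingType) (I : finType) (F : I -> I -> A) :
  \sum_(s : I * I) F s.1 s.2 * (s.1 == s.2)%:R = \sum_s F s s.
Proof.
rewrite -(pair_bigA _ (fun s s' => F s s' * (s == s')%:R)) /=.
apply: eq_bigr => s _; rewrite (bigD1 s) //= eqxx mulr1 big1 ?addr0 // => s'.
by rewrite eq_sym => /negPf->; rewrite mulr0.
Qed.

Lemma eq_mxtens_index m n (i i' : 'I_m) (j j' : 'I_n) :
  (ix i j == ix i' j') = (i == i') && (j == j').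
Proof. by rewrite (can_eq (@mxtens_indexK m n)). Qed.

Lemma tens_matrixP (T : Type) m n p q (A B : 'M[T]_(m * n, p * q)) :
  (forall i j k l, A (ix i j) (ix k l) = B (ix i j) (ix k l)) -> A = B.
Proof.
move=> eqAB; apply/matrixP => x y.
by case: (mxtens_indexP x) => i j; case: (mxtens_indexP y) => k l.
Qed.

Lemma tensmx11 (A : pzRingType) m n :
  (1%:M : 'M[A]_m) *t (1%:M : 'M[A]_n) = 1%:M.
Proof.
apply: tens_matrixP => i j k l.
by rewrite tensmxE !mxE eq_mxtens_index -natrM mulnb.
Qed.

End TensorIndices.

Section PartialTrace.
Variable R : realType.
Local Notation C := R[i].

Definition ptrace {m n} (A : 'M[C]_(m * n)) : 'M[C]_m :=
  \matrix_(a, b) \tr (blockmx A a b).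

Lemma ptraceE m n (A : 'M[C]_(m * n)) a b :
  ptrace A a b = \sum_t A (ix a t) (ix b t).
Proof. by rewrite mxE; apply: eq_bigr => t _; rewrite mxE. Qed.

Lemma ptrace_is_linear m n : linear (@ptrace m n).
Proof.
move=> c A B; apply/matrixP => a b; rewrite !mxE -linearP; congr mxtrace.
by apply/matrixP => t u; rewrite !mxE.
Qed.

HB.instance Definition _ m n :=
  GRing.isLinear.Build C 'M[C]_(m * n) 'M[C]_m _ (@ptrace m n)
    (@ptrace_is_linear m n).

Lemma mxtrace_ptrace m n (A : 'M[C]_(m * n)) : \tr (ptrace A) = \tr A.
Proof.
by rewrite /mxtrace sum_mxtens_index; apply: eq_bigr => a _; rewrite ptraceE.
Qed.

Lemma ptrace_tr m n (A : 'M[C]_(m * n)) : ptrace A^T = (ptrace A)^T.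
Proof.
apply/matrixP => a b; rewrite [RHS]mxE !ptraceE.
by apply: eq_bigr => t _; rewrite mxE.
Qed.

Lemma ptrace_scalar m n (c : C) :
  ptrace (c%:M : 'M[C]_(m * n)) = (c * n%:R)%:M.
Proof.
apply/matrixP => a b; rewrite ptraceE mxE.
under eq_bigr do rewrite mxE eq_mxtens_index eqxx andbT.
by rewrite sumr_const card_ord mulrnAC mulr_natr.
Qed.

End PartialTrace.

Section LinkProduct.
Variable R : realType.
Local Notation C := R[i].

(* Contraction of the shared middle tensor factor.  On Choi matrices it is the
   composition of maps; on a state and a Choi matrix it applies the map. *)
Definition link {k n p} (P : 'M[C]_(k * n)) (Q : 'M[C]_(n * p))
    : 'M[C]_(k * p) :=
  \matrix_(x, y) \sum_(s : 'I_n * 'I_n)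
    P (ix (mxtens_unindex x).1 s.1) (ix (mxtens_unindex y).1 s.2)
    * Q (ix s.1 (mxtens_unindex x).2) (ix s.2 (mxtens_unindex y).2).

Lemma linkE k n p (P : 'M[C]_(k * n)) (Q : 'M[C]_(n * p)) a t b u :
  link P Q (ix a t) (ix b u) =
  \sum_(s : 'I_n * 'I_n) P (ix a s.1) (ix b s.2) * Q (ix s.1 t) (ix s.2 u).
Proof. by rewrite mxE !mxtens_indexK. Qed.

Lemma link_is_linear k n p (P : 'M[C]_(k * n)) :
  linear (link P : 'M[C]_(n * p) -> _).
Proof.
move=> c A B; apply/matrixP => x y; rewrite !mxE mulr_sumr -big_split /=.
by apply: eq_bigr => s _; rewrite !mxE mulrDr mulrCA.
Qed.

HB.instance Definition _ k n p (P : 'M[C]_(k * n)) :=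
  GRing.isLinear.Build C 'M[C]_(n * p) 'M[C]_(k * p) _ (link P)
    (link_is_linear P).

Lemma linkZl k n p c (P : 'M[C]_(k * n)) (Q : 'M[C]_(n * p)) :
  link (c *: P) Q = c *: link P Q.
Proof.
apply/matrixP => x y; rewrite !mxE mulr_sumr.
by apply: eq_bigr => s _; rewrite mxE mulrA.
Qed.

Lemma linkA k n p q (P : 'M[C]_(k * n)) (Q : 'M[C]_(n * p))
    (S : 'M[C]_(p * q)) :
  link P (link Q S) = link (link P Q) S.
Proof.
apply: tens_matrixP => a t b u; rewrite !linkE.
under [RHS]eq_bigr do rewrite linkE mulr_suml.
rewrite [RHS]exchange_big; apply: eq_bigr => s _ /=.
by rewrite linkE mulr_sumr; apply: eq_bigr => r _; rewrite mulrA.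
Qed.

Lemma trmx_link k n p (P : 'M[C]_(k * n)) (Q : 'M[C]_(n * p)) :
  (link P Q)^T = link P^T Q^T.
Proof.
apply: tens_matrixP => a t b u; rewrite mxE !linkE.
rewrite (reindex_inj (can_inj (@swap_pairK _ _))) /=.
by apply: eq_bigr => s _; rewrite !mxE.
Qed.

Lemma adjmx_link k n p (P : 'M[C]_(k * n)) (Q : 'M[C]_(n * p)) :
  adjmx (link P Q) = link (adjmx P) (adjmx Q).
Proof.
rewrite /adjmx -trmx_link; congr _^T; apply: tens_matrixP => a t b u.
by rewrite mxE !linkE rmorph_sum; apply: eq_bigr => s _; rewrite rmorphM !mxE.
Qed.

Lemma ptrace_link k n p (P : 'M[C]_(k * n)) (Q : 'M[C]_(n * p)) :
  ptrace Q = 1%:M -> ptrace (link P Q) = ptrace P.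
Proof.
move=> /matrixP ptrQ; apply/matrixP => a b; rewrite !ptraceE.
under eq_bigr do rewrite linkE.
rewrite exchange_big /=; under eq_bigr do rewrite -mulr_sumr -ptraceE ptrQ mxE.
exact: sum_pair_delta (fun s s' => P (ix a s) (ix b s')).
Qed.

Lemma link1 k n p (P : 'M[C]_(k * n)) :
  link P (1%:M : 'M[C]_(n * p)) = ptrace P *t 1%:M.
Proof.
apply: tens_matrixP => a t b u; rewrite linkE tensmxE ptraceE mxE mulr_suml.
rewrite -(sum_pair_delta (fun s s' => P (ix a s) (ix b s') * (t == u)%:R)).
apply: eq_bigr => s _.
by rewrite mxE eq_mxtens_index -mulnb natrM mulrAC mulrA.
Qed.

Lemma psdmx_link k n p (P : 'M[C]_(k * n)) (Q : 'M[C]_(n * p)) :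
  psdmx P -> psdmx Q -> psdmx (link P Q).
Proof.
move=> /psdmxP[L ->] /psdmxP[K ->].
pose Z : 'M[C]_((k * n) * (n * p), k * p) := \matrix_(x, y)
  \sum_s L (mxtens_unindex x).1 (ix (mxtens_unindex y).1 s)
       * K (mxtens_unindex x).2 (ix s (mxtens_unindex y).2).
have ZE l m a t : Z (ix l m) (ix a t) = \sum_s L l (ix a s) * K m (ix s t).
  by rewrite mxE !mxtens_indexK.
suff -> : link (adjmx L *m L) (adjmx K *m K) = adjmx Z *m Z.
  exact: psdmx_gram.
apply: tens_matrixP => a t b u; rewrite linkE mxE sum_mxtens_index pair_bigA /=.
under eq_bigr do rewrite !mxE big_distrlr pair_bigA /=.
rewrite exchange_big; apply: eq_bigr => -[l m] _ /=.
rewrite adjmxE !ZE rmorph_sum big_distrlr pair_bigA; apply: eq_bigr => s _ /=.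
by rewrite !adjmxE rmorphM /=; ring.
Qed.

End LinkProduct.

Section Channels.
Variable R : realType.
Local Notation C := R[i].

(* Complete positivity becomes positivity of the Choi matrix, preservation of
   the trace becomes the condition on its partial trace. *)
Definition choimx {nS nT} (G : 'M[C]_(nS * nT)) : Prop :=
  psdmx G /\ ptrace G = 1%:M.

Definition choi_map {nS nT} (G : 'M[C]_(nS * nT)) (X : 'M[C]_nS) : 'M[C]_nT :=
  \matrix_(t, u) \sum_(s : 'I_nS * 'I_nS) X s.1 s.2 * G (ix s.1 t) (ix s.2 u).

Lemma choi_map_is_linear nS nT (G : 'M[C]_(nS * nT)) : linear (choi_map G).
Proof.
move=> c X Y; apply/matrixP => t u; rewrite !mxE mulr_sumr -big_split /=.
by apply: eq_bigr => s _; rewrite !mxE mulrDl mulrA.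
Qed.

HB.instance Definition _ nS nT (G : 'M[C]_(nS * nT)) :=
  GRing.isLinear.Build C 'M[C]_nS 'M[C]_nT _ (choi_map G)
    (choi_map_is_linear G).

Lemma id_tens_choi_map k nS nT (G : 'M[C]_(nS * nT)) (X : 'M[C]_(k * nS)) :
  id_tens (choi_map G) X = link X G.
Proof.
by apply/matrixP => x y; rewrite !mxE; apply: eq_bigr => s _; rewrite mxE.
Qed.

Lemma choi_map_cp nS nT (G : 'M[C]_(nS * nT)) :
  psdmx G -> completely_positive (choi_map G).
Proof.
by move=> psdG k X psdX; rewrite id_tens_choi_map; exact: psdmx_link.
Qed.

Lemma choi_map_tp nS nT (G : 'M[C]_(nS * nT)) :
  ptrace G = 1%:M -> trace_preserving (choi_map G).
Proof.
move=> /matrixP ptrG X; rewrite /mxtrace.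
under eq_bigr do rewrite mxE.
rewrite exchange_big /=.
under eq_bigr do rewrite -mulr_sumr -ptraceE ptrG mxE.
exact: sum_pair_delta.
Qed.

Definition vectmx {m n} (U : 'M[C]_(m, n)) : 'rV[C]_(m * n) :=
  \row_x U (mxtens_unindex x).1 (mxtens_unindex x).2.

(* The Choi matrix of [X |-> adjmx U *m X *m U]. *)
Definition conj_choi {m n} (U : 'M[C]_(m, n)) : 'M[C]_(m * n) :=
  adjmx (vectmx U) *m vectmx U.

Lemma conj_choiE m n (U : 'M[C]_(m, n)) a t b u :
  conj_choi U (ix a t) (ix b u) = (U a t)^* * U b u.
Proof. by rewrite mxE big_ord1 adjmxE !mxE !mxtens_indexK. Qed.

Lemma psdmx_conj_choi m n (U : 'M[C]_(m, n)) : psdmx (conj_choi U).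
Proof. exact: psdmx_gram. Qed.

Lemma ptrace_conj_choi m n (U : 'M[C]_(m, n)) :
  ptrace (conj_choi U) = (U *m adjmx U)^T.
Proof.
apply/matrixP => a b; rewrite ptraceE !mxE.
by apply: eq_bigr => t _; rewrite conj_choiE adjmxE mulrC.
Qed.

Lemma link_conj_choi k n p (X : 'M[C]_(k * n)) (U : 'M[C]_(n, p)) :
  link X (conj_choi U) = (1%:M *t adjmx U) *m X *m (1%:M *t U).
Proof.
apply: tens_matrixP => a t b u; rewrite linkE mxE sum_mxtens_index.
rewrite (bigD1 b) //= [X in _ + X]big1; last first.
  move=> c cDb; apply: big1 => s _.
  by rewrite tensmxE [1%:M _ _]mxE (negPf cDb) mul0r mulr0.
rewrite addr0 -(pair_bigA _ (fun s s' => X (ix a s) (ix b s') *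
  conj_choi U (ix s t) (ix s' u))) exchange_big; apply: eq_bigr => s' _ /=.
rewrite mxE sum_mxtens_index (bigD1 a) //= [X in _ + X]big1; last first.
  move=> c cDa; apply: big1 => s _.
  by rewrite tensmxE [1%:M _ _]mxE eq_sym (negPf cDa) !mul0r.
rewrite addr0 mulr_suml; apply: eq_bigr => s _.
by rewrite !tensmxE conj_choiE adjmxE !mxE !eqxx !mul1r mulrCA mulrA.
Qed.

Lemma link_conj_choi1 k n (X : 'M[C]_(k * n)) : link X (conj_choi 1%:M) = X.
Proof.
by rewrite link_conj_choi adjmx_scalar conjC1 tensmx11 mul1mx mulmx1.
Qed.

Lemma link_conj_choiM m n p (U : 'M[C]_(m, n)) (V : 'M[C]_(n, p)) :
  link (conj_choi U) (conj_choi V) = conj_choi (U *m V).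
Proof.
apply: tens_matrixP => a t b u; rewrite linkE conj_choiE !mxE rmorph_sum.
rewrite big_distrlr pair_bigA; apply: eq_bigr => s _ /=.
by rewrite !conj_choiE rmorphM /=; ring.
Qed.

Lemma mxtrace_link_conj_choi k n p (X : 'M[C]_(k * p)) (W : 'M[C]_(k * n))
    (U : 'M[C]_(n, p)) :
  \tr (link X (conj_choi (adjmx U)) *m W) = \tr (X *m link W (conj_choi U)).
Proof.
by rewrite !link_conj_choi adjmxK -!mulmxA mxtrace_mulC !mulmxA.
Qed.

Lemma choimx_conj_choi n (U : 'M[C]_n) :
  U \is unitarymx -> choimx (conj_choi U).
Proof.
move=> /unitarymxP unitU; split; first exact: psdmx_conj_choi.
by rewrite ptrace_conj_choi adjmx_trmxC unitU trmx1.
Qed.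

Lemma choimx_depolarizing nS nT : (0 < nT)%N ->
  choimx ((nT%:R^-1)%:M : 'M[C]_(nS * nT)).
Proof.
move=> nT_gt0; split; first by apply: psdmx_scalar; rewrite invr_ge0 ler0n.
by rewrite ptrace_scalar mulVf // pnatr_eq0 -lt0n.
Qed.

Lemma choimx_mxtrace nS nT (G : 'M[C]_(nS * nT)) : choimx G -> \tr G = nS%:R.
Proof. by move=> [_ ptrG]; rewrite -mxtrace_ptrace ptrG mxtrace1. Qed.

Definition choi {nS nT} (E : 'M[C]_nS -> 'M[C]_nT) : 'M[C]_(nS * nT) :=
  id_tens E (conj_choi 1%:M).

Lemma choiE nS nT (E : 'M[C]_nS -> 'M[C]_nT) s t s' t' :
  choi E (ix s t) (ix s' t') = E (delta_mx s s') t t'.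
Proof.
rewrite mxE !mxtens_indexK; congr (E _ _ _); apply/matrixP => x y.
rewrite mxE conj_choiE !mxE conjC_nat -natrM mulnb.
by rewrite [s == x]eq_sym [s' == y]eq_sym.
Qed.

Lemma id_tens_choi k nS nT (E : {linear 'M[C]_nS -> 'M[C]_nT})
    (X : 'M[C]_(k * nS)) :
  id_tens E X = link X (choi E).
Proof.
apply: tens_matrixP => a t b u; rewrite linkE mxE !mxtens_indexK /=.
rewrite [blockmx _ _ _]matrix_sum_delta pair_bigA linear_sum summxE.
by apply: eq_bigr => s _; rewrite choiE linearZ !mxE.
Qed.

Lemma choimx_choi nS nT (E : {linear 'M[C]_nS -> 'M[C]_nT}) :
  completely_positive E -> trace_preserving E -> choimx (choi E).
Proof.
move=> cpE tpE; split; first exact/cpE/psdmx_conj_choi.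
apply/matrixP => s s'; rewrite ptraceE; under eq_bigr do rewrite choiE.
rewrite -/(mxtrace (E _)) tpE /mxtrace (bigD1 s) //= big1 => [|x xDs].
  by rewrite !mxE eqxx addr0.
by rewrite mxE (negPf xDs).
Qed.

End Channels.

Section Games.
Variable R : realType.
Local Notation C := R[i].
Local Notation Re := (@complex.Re R).

Lemma density_dim_gt0 n (A : 'M[C]_n) : density A -> (0 < n)%N.
Proof.
case: n A => // A [_ /eqP].
by rewrite /mxtrace big_ord0 eq_sym oner_eq0.
Qed.

(* [link D^T rho] is the Choi matrix of what the observer does on outcome [D]:
   prepare [rho] and apply [D] to [S] and [A], which leaves a state on [B]. *)
Lemma mxtrace_reorder_tens nN nS nA nB (Phi : 'M[C]_(nN * nS))
    (rho : 'M[C]_(nA * nB)) (M : 'M[C]_(nN * nB)) (D : 'M[C]_(nS * nA)) :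
  \tr ((Phi *t rho) *m reorder_tens M D) = \tr (link Phi (link D^T rho) *m M).
Proof.
pose F n s a b n' s' a' b' :=
  Phi (ix n s) (ix n' s') * rho (ix a b) (ix a' b')
  * (M (ix n' b') (ix n b) * D (ix s' a') (ix s a)).
transitivity (\sum_n \sum_s \sum_a \sum_b \sum_n' \sum_s' \sum_a' \sum_b'
  F n s a b n' s' a' b').
  rewrite /mxtrace !sum_mxtens_index.
  apply: eq_bigr => n _; apply: eq_bigr => s _.
  rewrite sum_mxtens_index; apply: eq_bigr => a _; apply: eq_bigr => b _.
  rewrite mxE !sum_mxtens_index; apply: eq_bigr => n' _; apply: eq_bigr => s' _.
  rewrite sum_mxtens_index; apply: eq_bigr => a' _; apply: eq_bigr => b' _.
  by rewrite tensmxE [reorder_tens _ _ _ _]mxE /idx4 !mxtens_indexK.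
transitivity (\sum_n \sum_b \sum_n' \sum_b' \sum_s \sum_s' \sum_a \sum_a'
  F n s a b n' s' a' b').
  apply: eq_bigr => n _.
  under eq_bigr do rewrite exchange_big.
  rewrite exchange_big; apply: eq_bigr => b _ /=.
  under eq_bigr do rewrite exchange_big.
  rewrite exchange_big; apply: eq_bigr => n' _ /=.
  rewrite [RHS]exchange_big; apply: eq_bigr => s _ /=.
  rewrite exchange_big [RHS]exchange_big; apply: eq_bigr => s' _ /=.
  rewrite [RHS]exchange_big; apply: eq_bigr => a _ /=.
  by rewrite exchange_big.
rewrite /mxtrace sum_mxtens_index; apply: eq_bigr => n _; apply: eq_bigr => b _.
rewrite mxE sum_mxtens_index; apply: eq_bigr => n' _; apply: eq_bigr => b' _.
rewrite linkE mulr_suml pair_bigA; apply: eq_bigr => s _ /=.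
rewrite linkE mulr_sumr mulr_suml pair_bigA; apply: eq_bigr => a _.
by rewrite /F mxE; ring.
Qed.

Lemma payoff_link nN nS nT nA nB k (G : 'M[C]_(nS * nT))
    (Phi : 'M[C]_(nN * nS)) (rho : 'M[C]_(nA * nB))
    (M : 'I_k -> 'M[C]_(nN * nB)) (D : 'I_k -> 'M[C]_(nT * nA)) :
  payoff (link Phi G) rho M D = payoff Phi rho M (fun i => link G^T (D i)).
Proof.
apply: eq_bigr => i _.
by rewrite !mxtrace_reorder_tens trmx_link trmxK -!linkA.
Qed.

Lemma strategy_link nS nT nA k (G : 'M[C]_(nS * nT))
    (D : 'I_k -> 'M[C]_(nT * nA)) :
  choimx G -> strategy D -> strategy (fun i => link G^T (D i)).
Proof.
move=> [psdG ptrG] [psdD sumD]; split=> [i|].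
  by apply: psdmx_link; [exact: psdmx_tr | exact: psdD].
by rewrite -linear_sum /= sumD link1 ptrace_tr ptrG trmx1 tensmx11.
Qed.

Lemma strategy_exists nS nA k : (0 < k)%N ->
  exists D : 'I_k -> 'M[C]_(nS * nA), strategy D.
Proof.
case: k => // k _; exists (fun i => if i == ord0 then 1%:M else 0); split.
  by move=> i; case: eqP => _; [exact: psdmx_scalar | exact: psdmx0].
by rewrite -big_mkcond big_pred1_eq.
Qed.

Lemma strategy_normr_le nS nA k (D : 'I_k -> 'M[C]_(nS * nA)) i x y :
  strategy D -> `|D i x y| <= (nS * nA)%:R.
Proof.
move=> [psdD sumD]; apply: le_trans (psdmx_normr_le_trace _ _ (psdD i)) _.
rewrite -(mxtrace1 C (nS * nA)) -sumD raddf_sum (bigD1 i) //= lerDl.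
by apply: sumr_ge0 => j _; exact: psdmx_trace_ge0.
Qed.

Lemma normr_reorder_tens_le nN nS nA nB (M : 'M[C]_(nN * nB))
    (D : 'M[C]_(nS * nA)) (c : C) x y :
  (forall i j, `|D i j| <= c) ->
  `|reorder_tens M D x y| <= `|reorder_tens M (const_mx c) x y|.
Proof.
move=> leDc; rewrite !mxE /idx4.
case: (mxtens_unindex x) (mxtens_unindex y) => [u v] [u' v'].
case: (mxtens_unindex u) (mxtens_unindex v) => [n s] [a b].
case: (mxtens_unindex u') (mxtens_unindex v') => [n' s'] [a' b'].
rewrite !normrM mxE ler_wpM2l // [leRHS]ger0_norm; first exact: leDc.
exact: le_trans (normr_ge0 _) (leDc (ix s a) (ix s' a')).
Qed.

Lemma payoff_bounded nN nS nA nB k (Phi : 'M[C]_(nN * nS))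
    (rho : 'M[C]_(nA * nB)) (M : 'I_k -> 'M[C]_(nN * nB)) :
  exists b : R, forall D : 'I_k -> 'M[C]_(nS * nA), strategy D ->
    Re (payoff Phi rho M D) <= b.
Proof.
pose b : C := \sum_i \sum_x \sum_y `|(Phi *t rho) x y|
  * `|reorder_tens (M i) (const_mx (nS * nA)%:R : 'M[C]_(nS * nA)) y x|.
exists (Re b) => D stratD.
have : `|payoff Phi rho M D| <= b.
  apply: le_trans (ler_norm_sum _ _ _) _; apply: ler_sum => i _.
  apply: le_trans (ler_norm_sum _ _ _) _; apply: ler_sum => x _; rewrite mxE.
  apply: le_trans (ler_norm_sum _ _ _) _; apply: ler_sum => y _.
  rewrite normrM ler_wpM2l // normr_reorder_tens_le // => ? ?.
  exact: strategy_normr_le.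
move=> /(le_trans (normc_ge_Re _)); rewrite lecE => /andP[_ /=].
exact/le_trans/ler_norm.
Qed.

Lemma payoff_le_opt nN nS nA nB k (Phi : 'M[C]_(nN * nS))
    (rho : 'M[C]_(nA * nB)) (M : 'I_k -> 'M[C]_(nN * nB))
    (D : 'I_k -> 'M[C]_(nS * nA)) :
  strategy D -> Re (payoff Phi rho M D) <= opt_payoff Phi rho M.
Proof.
move=> stratD; apply: ub_le_sup; last by exists D.
have [b le_b] := payoff_bounded Phi rho M.
by exists b => _ [D' stratD' <-]; exact: le_b.
Qed.

Lemma opt_payoff_le nN nS nA nB k (Phi : 'M[C]_(nN * nS))
    (rho : 'M[C]_(nA * nB)) (M : 'I_k -> 'M[C]_(nN * nB)) (b : R) :
  (0 < k)%N ->
  (forall D : 'I_k -> 'M[C]_(nS * nA), strategy D ->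
    Re (payoff Phi rho M D) <= b) ->
  opt_payoff Phi rho M <= b.
Proof.
move=> k_gt0 le_b; apply: ge_sup; last by move=> _ [D stratD <-]; exact: le_b.
have [D stratD] := strategy_exists nS nA k_gt0.
by exists (Re (payoff Phi rho M D)); exists D.
Qed.

Lemma choimx_better nN nS nT (G : 'M[C]_(nS * nT)) (Phi : 'M[C]_(nN * nS)) :
  choimx G -> better Phi (link Phi G).
Proof.
move=> choiG nA nB rho k M _ k_gt0 _; apply: opt_payoff_le => // D stratD.
by rewrite payoff_link; apply/payoff_le_opt/strategy_link.
Qed.

End Games.

Lemma sum_signs (K : numDomainType) (I : finType) (t u : I) :
  \sum_(e : {ffun I -> bool}) (-1) ^+ e t * (-1) ^+ e u
  = #|{ffun I -> bool}|%:R * (t == u)%:R :> K.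
Proof.
case: eqVneq => [<-|tDu].
  by under eq_bigr do rewrite -expr2 sqrr_sign; rewrite sumr_const mulr1.
rewrite mulr0; set S := LHS.
suff SN : S = - S.
  by have := mulrn_eq0 S 2; rewrite mulr2n {1}SN addNr eqxx => /esym/eqP.
pose flip (e : {ffun I -> bool}) := [ffun j => e j (+) (j == t)].
have flipK : involutive flip.
  by move=> e; apply/ffunP => j; rewrite !ffunE addbK.
rewrite {1}/S (reindex_inj (inv_inj flipK)) -sumrN; apply: eq_bigr => e _.
by rewrite !ffunE eqxx eq_sym (negPf tDu) addbF addbT signrN mulNr.
Qed.

Lemma sum_shift_delta (K : pzSemiRingType) (V : finZmodType) (t a b : V) :
  \sum_r (a == t + r)%:R * (b == t + r)%:R = (a == b)%:R :> K.
Proof.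
rewrite (bigD1 (a - t)) //= big1 => [|r rDat].
  by rewrite addr0 subrKC eqxx mul1r eq_sym.
rewrite (_ : (a == t + r) = false) ?mul0r //.
by apply: contraNF rDat => /eqP->; rewrite addrC addKr.
Qed.

Section UnitaryDesigns.
Variable R : realType.
Local Notation C := R[i].

Definition unitary_1design {I : finType} {d} (U : I -> 'M[C]_d) : Prop :=
  (forall i, U i \is unitarymx) /\
  \sum_i conj_choi (U i) = (#|I|%:R / d%:R)%:M.

(* Signs play the role of the usual roots of unity in the Weyl operators, at the
   price of a larger family. *)
Definition signed_shift {d} (w : {ffun 'I_d.+1 -> bool} * 'I_d.+1)
    : 'M[C]_d.+1 :=
  \matrix_(a, t) ((a == t + w.2)%:R * (-1) ^+ w.1 t).

Lemma conj_signed_shift d w a t :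
  (@signed_shift d w a t)^* = signed_shift w a t.
Proof. by rewrite mxE rmorphM /= conjC_nat rmorphXn /= rmorphN1. Qed.

Lemma signed_shift_unitary d w : @signed_shift d w \is unitarymx.
Proof.
apply/unitarymxP; rewrite -adjmx_trmxC; apply/matrixP => a b.
rewrite mxE [RHS]mxE -(sum_shift_delta C w.2); apply: eq_bigr => t _.
rewrite adjmxE conj_signed_shift !mxE mulrACA -expr2 sqrr_sign mulr1.
by rewrite ![t + _]addrC.
Qed.

Lemma signed_shift_design d : unitary_1design (@signed_shift d).
Proof.
split; first exact: signed_shift_unitary.
apply: tens_matrixP => a t b u; rewrite summxE [RHS]mxE eq_mxtens_index.
under eq_bigr do rewrite conj_choiE conj_signed_shift.
rewrite -(pair_bigA _ (fun e r =>
  signed_shift (e, r) a t * signed_shift (e, r) b u)) /=.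
transitivity ((\sum_(e : {ffun 'I_d.+1 -> bool}) (-1) ^+ e t * (-1) ^+ e u)
  * (\sum_r (a == t + r)%:R * (b == u + r)%:R) : C).
  rewrite big_distrlr; apply: eq_bigr => e _; apply: eq_bigr => r _.
  by rewrite !mxE /=; ring.
rewrite sum_signs card_prod card_ord natrM mulfK ?pnatr_eq0 // -mulrA.
rewrite -[RHS]mulr_natr; congr (_ * _); case: eqVneq => [->|_].
  by rewrite andbT mul1r sum_shift_delta.
by rewrite andbF mul0r.
Qed.

Lemma unitary_1design_exists d : (0 < d)%N ->
  exists k, exists2 U : 'I_k -> 'M[C]_d, (0 < k)%N & unitary_1design U.
Proof.
case: d => // d _; pose I : finType := ({ffun 'I_d.+1 -> bool} * 'I_d.+1)%type.
have [unitU sumU] := signed_shift_design d.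
exists #|I|, (fun i => signed_shift (enum_val i : I)).
  by apply/card_gt0P; exists ([ffun=> false], ord0).
split=> [i|]; first exact: unitU.
rewrite -(big_enum_val (fun w => conj_choi (signed_shift w))) card_ord -sumU.
exact: eq_bigl.
Qed.

End UnitaryDesigns.

Section Teleportation.
Variable R : realType.
Local Notation C := R[i].

Definition max_entangled d : 'M[C]_(d * d) := d%:R^-1 *: conj_choi 1%:M.

Lemma density_max_entangled d : (0 < d)%N -> density (max_entangled d).
Proof.
move=> d_gt0; split.
  by apply: psdmxZ; [rewrite invr_ge0 ler0n | exact: psdmx_conj_choi].
rewrite linearZ /= -mxtrace_ptrace ptrace_conj_choi mul1mx adjmx_scalar conjC1.
by rewrite trmx1 mxtrace1 mulVf // pnatr_eq0 -lt0n.
Qed.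

(* The channel that measures [D] on [S] and half of a maximally entangled pair,
   then undoes [U i] on the other half when the outcome is [i]. *)
Definition measure_correct {nS d k} (U : 'I_k -> 'M[C]_d)
    (D : 'I_k -> 'M[C]_(nS * d)) : 'M[C]_(nS * d) :=
  d%:R^-1 *: \sum_i link (D i)^T (conj_choi (adjmx (U i))).

Lemma payoff_max_entangled nN nS d k (U : 'I_k -> 'M[C]_d)
    (Phi : 'M[C]_(nN * nS)) (W : 'M[C]_(nN * d)) (D : 'I_k -> 'M[C]_(nS * d)) :
  payoff Phi (max_entangled d) (fun i => link W (conj_choi (U i))) D
  = \tr (link Phi (measure_correct U D) *m W).
Proof.
rewrite /payoff linearZ linear_sum -scalemxAl mulmx_suml linearZ /=.
rewrite raddf_sum mulr_sumr; apply: eq_bigr => i _ /=.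
rewrite mxtrace_reorder_tens -mxtrace_link_conj_choi [in RHS]linkA.
by rewrite !linearZ /= link_conj_choi1 linkZl -scalemxAl linearZ.
Qed.

Lemma choimx_measure_correct nS d k (U : 'I_k -> 'M[C]_d)
    (D : 'I_k -> 'M[C]_(nS * d)) :
  (0 < d)%N -> (forall i, U i \is unitarymx) -> strategy D ->
  choimx (measure_correct U D).
Proof.
move=> d_gt0 unitU [psdD sumD].
have choiU i : choimx (conj_choi (adjmx (U i))).
  by apply: choimx_conj_choi; rewrite adjmx_trmxC trmxC_unitary.
split.
  apply: psdmxZ; first by rewrite invr_ge0 ler0n.
  apply: psdmx_sum => i; apply: psdmx_link; first exact: psdmx_tr.
  by have [] := choiU i.
rewrite linearZ linear_sum /= (eq_bigr (fun i => ptrace (D i)^T)); last first.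
  by move=> i _; rewrite ptrace_link //; have [] := choiU i.
rewrite -!linear_sum /= sumD trmx1 ptrace_scalar mul1r scale_scalar_mx.
by rewrite mulVf // pnatr_eq0 -lt0n.
Qed.

Definition bell_measurement {k d} (U : 'I_k -> 'M[C]_d) (i : 'I_k)
    : 'M[C]_(d * d) :=
  (d%:R / k%:R) *: (conj_choi (U i))^T.

Lemma strategy_bell_measurement k d (U : 'I_k -> 'M[C]_d) :
  (0 < k)%N -> (0 < d)%N -> unitary_1design U -> strategy (bell_measurement U).
Proof.
move=> k_gt0 d_gt0 [_ sumU]; split=> [i|].
  apply: psdmxZ; first by rewrite divr_ge0 ?ler0n.
  exact/psdmx_tr/psdmx_conj_choi.
rewrite -scaler_sumr -linear_sum /= sumU card_ord tr_scalar_mx scale_scalar_mx.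
by rewrite mulrA divfK ?divff // pnatr_eq0 -lt0n.
Qed.

Lemma measure_correct_bell k d (U : 'I_k -> 'M[C]_d) :
  (0 < k)%N -> (0 < d)%N -> (forall i, U i \is unitarymx) ->
  measure_correct U (bell_measurement U) = conj_choi 1%:M.
Proof.
move=> k_gt0 d_gt0 unitU; rewrite /measure_correct.
under eq_bigr => i _.
  rewrite linearZ /= trmxK linkZl link_conj_choiM adjmx_trmxC.
  have /unitarymxP-> := unitU i.
  over.
rewrite sumr_const card_ord scalerMnl scalerA -[_ / _ *+ _]mulr_natr.
by rewrite divfK ?mulVf ?scale1r // pnatr_eq0 -lt0n.
Qed.

End Teleportation.

Section MatrixTopology.
Local Open Scope classical_set_scope.

Lemma continuous_matrix (T U : topologicalType) m n (f : T -> 'M[U]_(m, n)) :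
  (forall i j, continuous (fun x => f x i j)) -> continuous f.
Proof.
move=> fij x A [P nbhsP subA].
apply: (@filterS _ (nbhs x) _ [set y | forall i j, P i j (f y i j)]).
  by move=> y Py; exact: subA.
by apply: filter_forall => i; apply: filter_forall => j; exact: fij (nbhsP i j).
Qed.

Lemma continuous_coord (T : topologicalType) (K : numFieldType) m n
    (f : T -> 'M[K]_(m, n)) i j :
  continuous f -> continuous (fun x => f x i j).
Proof.
move=> contf x; apply: (@continuous_comp _ _ _ f (fun M => M i j)).
  exact: contf.
exact: coord_continuous.
Qed.

Lemma continuous_sum (T : topologicalType) (K : numFieldType) (I : finType)
    (F : I -> T -> K) :
  (forall i, continuous (F i)) -> continuous (fun x => \sum_i F i x).
Proof. by move=> contF; apply: continuous_big => //; exact: add_continuous. Qed.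

Lemma continuous_mulmx (T : topologicalType) (K : numFieldType) m n p
    (f : T -> 'M[K]_(m, n)) (g : T -> 'M[K]_(n, p)) :
  continuous f -> continuous g -> continuous (fun x => f x *m g x).
Proof.
move=> contf contg; apply: continuous_matrix => i j.
under eq_fun do rewrite mxE; apply: continuous_sum => k x.
by apply: continuousM; exact: continuous_coord.
Qed.

Lemma linear_mx_continuous (K : numFieldType) m n p q
    (f : {linear 'M[K]_(m, n) -> 'M[K]_(p, q)}) : continuous f.
Proof.
apply: continuous_matrix => i j.
have fE A : f A i j =
    \sum_(kl : 'I_m * 'I_n) A kl.1 kl.2 * f (delta_mx kl.1 kl.2) i j.
  rewrite {1}[A]matrix_sum_delta pair_bigA linear_sum summxE.
  by apply: eq_bigr => kl _; rewrite linearZ mxE.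
under eq_fun do rewrite fE; apply: continuous_sum => kl A.
by apply: continuousM; [exact: coord_continuous | exact: cst_continuous].
Qed.

Lemma closed_eq_continuous (T : topologicalType) (K : numFieldType)
    (V : pseudoMetricNormedZmodType K) (f g : T -> V) :
  continuous f -> continuous g -> closed [set x | f x = g x].
Proof.
move=> contf contg.
rewrite (_ : [set _ | _] = (fun x => f x - g x) @^-1` [set 0]); last first.
  by apply/seteqP; split=> x /=; [move=> ->; rewrite subrr | exact: subr0_eq].
apply: (continuous_closedP _).1.
  by move=> x; apply: cvgB; [exact: contf | exact: contg].
exact/accessible_closed_set1/hausdorff_accessible/norm_hausdorff.
Qed.

Lemma epsilon_delta_continuous (K L : numFieldType)
    (V : pseudoMetricNormedZmodType K) (W : pseudoMetricNormedZmodType L)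
    (f : V -> W) :
  (forall x e, 0 < e ->
    exists2 d, 0 < d & forall y, `|x - y| < d -> `|f x - f y| < e) ->
  continuous f.
Proof.
move=> dist_f x; apply/cvgrPdist_lt => e /(dist_f x)[d d_gt0 lt_e].
by near=> y; apply: lt_e; near: y; apply: cvgr_dist_lt => //; exact: cvg_id.
Unshelve. all: by end_near. Qed.

End MatrixTopology.

Section ComplexTopology.
Local Open Scope classical_set_scope.
Variable R : realType.
(* The cast gives the complex numbers the topology that every [numFieldType]
   carries. *)
Local Notation C := (R[i] : numFieldType).
Local Notation Re := (@complex.Re R).
Local Notation Im := (@complex.Im R).

Lemma normc_ge_Im (z : R[i]) : `|Im z|%:C%C <= `|z|.
Proof.
have <- : `|z * 'i%C| = `|z|.
  by rewrite normrM [`|'i%C|]normc_def /= expr0n expr1n add0r sqrtr1 mulr1.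
by rewrite -normrN -ReiNIm; exact: normc_ge_Re.
Qed.

Lemma continuous_Re : continuous (Re : C -> R).
Proof.
apply: epsilon_delta_continuous => z e e_gt0; exists e%:C%C => [|w].
  by rewrite ltcR.
by rewrite -ltcR -raddfB; apply/le_lt_trans/normc_ge_Re.
Qed.

Lemma continuous_real_complex : continuous (real_complex R : R -> C).
Proof.
apply: epsilon_delta_continuous => x e e_gt0.
have ReE : (Re e)%:C%C = e by rewrite RRe_real // gtr0_real.
exists (Re e) => [|y lt_Re]; first by rewrite -ltcR ReE.
by rewrite -rmorphB normc_def /= expr0n addr0 sqrtr_sqr -[ltRHS]ReE ltcR.
Qed.

Lemma continuous_conj : continuous (Num.conj : C -> C).
Proof.
apply: epsilon_delta_continuous => z e e_gt0; exists e => // w.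
by rewrite -rmorphB norm_conjC.
Qed.

Lemma compact_square (b : R) :
  compact [set z : C | `|Re z| <= b /\ `|Im z| <= b].
Proof.
pose f (p : R * R) : C := p.1%:C%C + 'i%C * p.2%:C%C.
have cont_real_complex (g : R * R -> R) :
    continuous g -> continuous (fun p => (g p)%:C%C : C).
  move=> contg p; apply: continuous_comp; first exact: contg.
  exact: continuous_real_complex.
have contf : continuous f.
  move=> p; apply: cvgD; first by apply: cont_real_complex => ?; exact: cvg_fst.
  apply: cvgM; first exact: cvg_cst.
  by apply: cont_real_complex => ?; exact: cvg_snd.
rewrite (_ : [set _ | _] = f @` ([set` `[- b, b]%R] `*` [set` `[- b, b]%R])).
  apply: continuous_compact; first exact: continuous_subspaceT.
  by apply: compact_setX; exact: segment_compact.
apply/seteqP; split=> [z [Rez Imz]|_ [[x y] [/= xb yb] <-]].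
  exists (Re z, Im z); last by rewrite /f -complexE.
  by split; rewrite /= in_itv /= -ler_norml.
by rewrite /f -(complexE (x +i* y)%C) /= !ler_norml; split; rewrite -?in_itv.
Qed.

Lemma closed_bounded_mx_compact m n (A : set 'M[C]_(m, n)) (b : R) :
  closed A -> (forall M, A M -> forall i j, `|M i j| <= b%:C%C) -> compact A.
Proof.
move=> closedA boundedA.
pose square := [set z : C | `|Re z| <= b /\ `|Im z| <= b].
pose B := [set v : 'rV[C]_(m * n) | forall i, square (v ord0 i)].
apply: (@subclosed_compact _ A (vec_mx @` B)) => //.
  apply: continuous_compact.
    by apply: continuous_subspaceT; exact: linear_mx_continuous.
  by apply: (@rV_compact C _ (fun=> square)) => i; exact: compact_square.
move=> M AM; exists (mxvec M); last exact: mxvecK.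
move=> i; case/mxvec_indexP: i => i j; rewrite mxvecE /square /= -!lecR.
split; apply: le_trans (boundedA M AM i j); first exact: normc_ge_Re.
exact: normc_ge_Im.
Qed.

Lemma continuous_adjmx m n :
  continuous (@adjmx R m n : 'M[C]_(m, n) -> 'M[C]_(n, m)).
Proof.
apply: continuous_matrix => i j; under eq_fun do rewrite adjmxE.
move=> A.
apply: (@continuous_comp _ _ _ (fun M : 'M[C]_(m, n) => M j i) Num.conj).
  exact: coord_continuous.
exact: continuous_conj.
Qed.

Lemma closed_ge0 : closed [set z : C | 0 <= z].
Proof.
rewrite (_ : [set _ | _] = [set z : C | z = `|z|]); last first.
  by apply/seteqP; split=> z /=; [move/ger0_norm | move=> ->].
by apply: (@closed_eq_continuous C C C id) => [z //|]; exact: norm_continuous.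
Qed.

Lemma closed_psdmx n : closed [set A : 'M[C]_n | psdmx A].
Proof.
pose form (v : 'rV[C]_n) (A : 'M[C]_n) : C := (v *m A *m adjmx v) 0 0.
rewrite (_ : [set _ | _] = [set A | adjmx A = A] `&`
  \bigcap_(v in setT) form v @^-1` [set z | 0 <= z]); last first.
  apply/seteqP; split=> A [hermA posA]; split=> // v; last exact: posA.
  by move=> _; exact: posA.
apply: closedI; last apply: closed_bigI => v _.
  by apply: closed_eq_continuous => [|A //]; exact: continuous_adjmx.
apply: (continuous_closedP _).1 closed_ge0; apply: continuous_coord.
exact: linear_mx_continuous (mulmxr (adjmx v) \o mulmx v).
Qed.

End ComplexTopology.

Section ConvexSets.
Local Open Scope classical_set_scope.
Local Open Scope convex_scope.

Lemma conv_lmodE (K : numDomainType) (V : lmodType K) (p : {i01 K})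
    (x y : convex_lmodType V) :
  x <| p |> y = p%:inum *: (x : V) + (1 - p%:inum) *: (y : V).
Proof. by []. Qed.

Lemma convex_set_linear_image (K : numDomainType) (V W : lmodType K)
    (f : {linear V -> W}) (A : set V) :
  convex_set A -> convex_set (f @` A).
Proof.
move=> convexA _ _ p /set_mem[x Ax <-] /set_mem[y Ay <-]; apply: mem_set.
exists ((x : convex_lmodType V) <| p |> y).
  exact: set_mem (convexA x y p (mem_set Ax) (mem_set Ay)).
by rewrite !conv_lmodE linearD !linearZ.
Qed.

End ConvexSets.

Lemma quadratic_slope_le0 (R : realFieldType) (a b : R) :
  (forall t, 0 <= t <= 1 -> t * a *+ 2 <= t ^+ 2 * b) -> a <= 0.
Proof.
move=> quad; rewrite leNgt; apply/negP => a_gt0.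
have ab_gt0 : 0 < a + `|b| by rewrite ltr_pwDl.
pose t := a / (a + `|b|).
have t_gt0 : 0 < t by rewrite divr_gt0.
have tE : t * (a + `|b|) = a by rewrite divfK // gt_eqF.
have t_le1 : t <= 1 by rewrite ler_pdivrMr // mul1r lerDl.
have := quad t; rewrite ltW // t_le1 => /(_ isT).
rewrite -mulrnAr expr2 -mulrA ler_pM2l //.
have : t * b <= t * `|b| by rewrite ler_pM2l // ler_norm.
have : 0 < t * a by rewrite mulr_gt0.
by move: tE; rewrite mulrDr; lra.
Qed.

Section Separation.
Local Open Scope classical_set_scope.
Variable R : realType.
Local Notation C := (R[i] : numFieldType).
Local Notation Re := (@complex.Re R).

Definition hsdot {m n} (X Y : 'M[C]_(m, n)) : R := Re (\tr (X *m adjmx Y)).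

Lemma hsdotBl m n (X Y Z : 'M[C]_(m, n)) :
  hsdot (X - Y) Z = hsdot X Z - hsdot Y Z.
Proof. by rewrite /hsdot mulmxBl !raddfB. Qed.

Lemma hsdotZl m n (t : R) (X Y : 'M[C]_(m, n)) :
  hsdot (t%:C%C *: X) Y = t * hsdot X Y.
Proof.
rewrite /hsdot -scalemxAl linearZ /=.
by case: (\tr _) => x y /=; rewrite mul0r subr0.
Qed.

Lemma hsdotC m n (X Y : 'M[C]_(m, n)) : hsdot X Y = hsdot Y X.
Proof.
rewrite /hsdot -{1}[X]adjmxK -adjmxM mxtrace_adjmx.
by case: (\tr _).
Qed.

Lemma hsdot_subZ m n (t : R) (X Y : 'M[C]_(m, n)) :
  hsdot (X - t%:C%C *: Y) (X - t%:C%C *: Y)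
  = hsdot X X - t * hsdot Y X *+ 2 + t ^+ 2 * hsdot Y Y.
Proof.
rewrite hsdotBl hsdotZl !(hsdotC _ (X - _)) !hsdotBl !hsdotZl (hsdotC X Y).
by ring.
Qed.

Lemma hsdotxxE m n (X : 'M[C]_(m, n)) :
  (hsdot X X)%:C%C = \sum_(ij : 'I_m * 'I_n) `|X ij.1 ij.2| ^+ 2.
Proof.
have normE : \tr (X *m adjmx X) = \sum_(ij : 'I_m * 'I_n) `|X ij.1 ij.2| ^+ 2.
  rewrite -(pair_bigA _ (fun i j => `|X i j| ^+ 2)).
  apply: eq_bigr => i _; rewrite mxE; apply: eq_bigr => j _.
  by rewrite adjmxE normCK.
by rewrite /hsdot normE RRe_real // ger0_real // sumr_ge0.
Qed.

Lemma hsdotxx_le0 m n (X : 'M[C]_(m, n)) : hsdot X X <= 0 -> X = 0.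
Proof.
rewrite -lecR hsdotxxE => le0.
have sq_ge0 (ij : 'I_m * 'I_n) : true -> 0 <= `|X ij.1 ij.2| ^+ 2.
  by rewrite exprn_ge0.
have /(psumr_eq0P sq_ge0) X0 : \sum_(ij : 'I_m * 'I_n) `|X ij.1 ij.2| ^+ 2 = 0.
  by apply/eqP; rewrite eq_le le0 sumr_ge0.
apply/matrixP => i j; apply/eqP; rewrite mxE -normr_eq0 -sqrf_eq0.
by rewrite (X0 (i, j)).
Qed.

Lemma continuous_hsdotxx m n : continuous (fun X : 'M[C]_(m, n) => hsdot X X).
Proof.
pose sq (X : 'M[C]_(m, n)) : C := \sum_i (X *m adjmx X) i i.
have cont_sq : continuous sq.
  apply: continuous_sum => i; apply/continuous_coord/continuous_mulmx.
    by move=> X.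
  exact: continuous_adjmx.
move=> X; apply: (@continuous_comp _ _ _ sq Re); first exact: cont_sq.
exact: continuous_Re.
Qed.

Lemma convex_set_segment m n (K : set 'M[C]_(m, n)) (Y Y' : 'M[C]_(m, n))
    (t : R) :
  convex_set K -> K Y -> K Y' -> 0 <= t -> t <= 1 -> K (Y + t%:C%C *: (Y' - Y)).
Proof.
move=> convexK KY KY' t_ge0 t_le1.
have tc_ge0 : 0 <= t%:C%C :> C by rewrite ler0c.
have tc_le1 : t%:C%C <= 1 :> C by rewrite -(rmorph1 (real_complex R)) lecR.
have -> : Y + t%:C%C *: (Y' - Y) = t%:C%C *: Y' + (1 - t%:C%C) *: Y.
  by rewrite scalerBr scalerBl scale1r addrCA.
exact: set_mem (convexK Y' Y (Itv01 tc_ge0 tc_le1) (mem_set KY') (mem_set KY)).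
Qed.

(* [Y] is the point of [K] closest to [Z]: moving from [Y] towards another point
   of [K] cannot decrease the distance to first order. *)
Lemma convex_compact_projection m n (K : set 'M[C]_(m, n)) (Z : 'M[C]_(m, n)) :
  compact K -> K !=set0 -> convex_set K ->
  exists2 Y, K Y & forall Y', K Y' -> hsdot (Y' - Y) (Z - Y) <= 0.
Proof.
move=> compactK K_neq0 convexK.
pose dist2 Y := hsdot (Z - Y) (Z - Y).
have cont_dist2 : continuous dist2.
  move=> Y; apply: (@continuous_comp _ _ _ (fun Y : 'M[C]_(m, n) => Z - Y)
    (fun X : 'M[C]_(m, n) => hsdot X X)).
    apply: continuousB; [exact: cst_continuous | by move=> ?].
  exact: continuous_hsdotxx.
have [Y /set_mem KY minY] := compact_EVT_min K_neq0 compactK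
  (continuous_subspaceT cont_dist2).
exists Y => // Y' KY'.
apply: (@quadratic_slope_le0 _ _ (hsdot (Y' - Y) (Y' - Y))).
move=> t /andP[t_ge0 t_le1].
have := minY _ (mem_set (convex_set_segment convexK KY KY' t_ge0 t_le1)).
by rewrite /dist2 opprD addrA hsdot_subZ -addrA lerDl addrC subr_ge0.
Qed.

Lemma hermitian_separation n (K : set 'M[C]_n) (Z : 'M[C]_n) :
  compact K -> K !=set0 -> convex_set K ->
  hermitianmx Z -> (forall Y, K Y -> hermitianmx Y) ->
  (forall W b, hermitianmx W -> (forall Y, K Y -> Re (\tr (Y *m W)) <= b) ->
    Re (\tr (Z *m W)) <= b) ->
  K Z.
Proof.
move=> compactK K_neq0 convexK hermZ hermK supportZ.
have [Y KY projY] := convex_compact_projection Z compactK K_neq0 convexK.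
have hermW : hermitianmx (Z - Y).
  by rewrite /hermitianmx adjmxB hermZ hermK.
have hsdotW X : hsdot X (Z - Y) = Re (\tr (X *m (Z - Y))).
  by rewrite /hsdot hermW.
suff /hsdotxx_le0/subr0_eq-> : hsdot (Z - Y) (Z - Y) <= 0 by [].
rewrite hsdotBl subr_le0 !hsdotW; apply: supportZ => // Y' KY'.
by rewrite -!hsdotW -subr_le0 -hsdotBl projY.
Qed.

End Separation.

Section Comparison.
Local Open Scope classical_set_scope.
Variable R : realType.
Local Notation C := (R[i] : numFieldType).
Local Notation Re := (@complex.Re R).

Lemma compact_choimx nS nT : compact [set G : 'M[C]_(nS * nT) | choimx G].
Proof.
apply: (@closed_bounded_mx_compact R _ _ _ nS%:R) => [|G choiG i j]; last first.
  have [psdG _] := choiG.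
  by rewrite rmorph_nat -(choimx_mxtrace choiG); exact: psdmx_normr_le_trace.
apply: closedI; first exact: closed_psdmx.
apply: closed_eq_continuous; last exact: cst_continuous.
exact: linear_mx_continuous (@ptrace R nS nT).
Qed.

Lemma convex_choimx nS nT : convex_set [set G : 'M[C]_(nS * nT) | choimx G].
Proof.
move=> G G' p /set_mem[psdG ptrG] /set_mem[psdG' ptrG']; apply: mem_set; split.
  by apply: psdmxD; apply: psdmxZ; rewrite ?subr_ge0 ?ge0 ?le1.
by rewrite conv_lmodE linearD !linearZ /= ptrG ptrG' -scalerDl subrKC scale1r.
Qed.

Lemma better_channel nN nS nT (Phi : 'M[C]_(nN * nS)) (Psi : 'M[C]_(nN * nT)) :
  density Phi -> density Psi -> better Phi Psi ->
  exists2 G, choimx G & Psi = link Phi G.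
Proof.
move=> densPhi densPsi betterPhi.
have /andP[_ nT_gt0] : (0 < nN)%N && (0 < nT)%N.
  by rewrite -muln_gt0; exact: density_dim_gt0 densPsi.
have [k [U k_gt0 designU]] := unitary_1design_exists R nT_gt0.
have [unitU _] := designU; have [hermPhi _] := densPhi.1.
pose channels := [set G : 'M[C]_(nS * nT) | choimx G].
suff [G choiG <-] : (link Phi @` channels) Psi by exists G.
apply: hermitian_separation => [||||_ [G [[hermG _] _] <-]|W b hermW le_b].
- apply: continuous_compact; last exact: compact_choimx.
  by apply: continuous_subspaceT; exact: linear_mx_continuous.
- exists (link Phi (nT%:R^-1)%:M), (nT%:R^-1)%:M => //.
  exact: choimx_depolarizing.
- exact: convex_set_linear_image (@convex_choimx _ _).
- exact: densPsi.1.1.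
- by rewrite /hermitianmx adjmx_link hermPhi hermG.
have hermM i : hermitianmx (link W (conj_choi (U i))).
  by rewrite /hermitianmx adjmx_link hermW (psdmx_conj_choi _).1.
rewrite -[Psi in leLHS]link_conj_choi1.
rewrite -(measure_correct_bell k_gt0 nT_gt0 unitU) -payoff_max_entangled.
have stratU := strategy_bell_measurement k_gt0 nT_gt0 designU.
apply: le_trans (payoff_le_opt _ _ _ stratU) _.
have densAB := density_max_entangled R nT_gt0.
apply: le_trans (betterPhi _ _ _ _ _ densAB k_gt0 hermM) _.
apply: opt_payoff_le => // D stratD.
rewrite payoff_max_entangled; apply: le_b; exists (measure_correct U D) => //.
exact: choimx_measure_correct.
Qed.

End Comparison.

Theorem theorem2 (R : realType) (nN nS nT : nat)
  (Phi : 'M[R[i]]_(nN * nS)) (Psi : 'M[R[i]]_(nN * nT)) :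
  density Phi -> density Psi ->
  (better Phi Psi <->
   exists E : {linear 'M[R[i]]_nS -> 'M[R[i]]_nT},
     completely_positive E /\ trace_preserving E /\ Psi = id_tens E Phi).
Proof.
move=> densPhi densPsi; split.
  move=> /(better_channel densPhi densPsi)[G [psdG ptrG] ->].
  exists (choi_map G).
  split; first exact: choi_map_cp.
  by split; [exact: choi_map_tp | rewrite id_tens_choi_map].
move=> [E [cpE [tpE ->]]]; rewrite id_tens_choi.
exact/choimx_better/choimx_choi.
Qed.
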